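(* The measures $\omega_n$ on $S_n$ ($n\ge1$) have the following properties. (1) The measure $|\omega_n|$ has total mass $1$, so is a probability measure. (2) For $n=2m+1$ the measure $\omega_{2m+1}$ is nonnegative and has total mass $1$, so is a probability measure. It is supported on even permutations, so its restriction to the alternating group $A_n$ is a probability measure. (3) For $n=2m$ the measure $\omega_{2m}$ is a signed measure having total signed mass $0$. It is nonnegative on odd permutations, and there has total mass $\frac12$. It is nonpositive on even permutations, and there has total signed mass $-\frac12$. Thus the measure $-2\,\omega_{2m}|_{A_{2m}}$, restricted to the alternating group $A_{2m}$, is a probability measure. (4) Let $n=\prod_i p_i^{e_i}$ be the prime factorization of $n$. For any factorization $ab=n$ there holds $$\omega_n(C_{[b^a]})=\prod_i\omega_{p_i^{e_i}}\big(C_{[(b_i)^{a_i}]}\big),$$ in which $b_i=p_i^{e_{i,2}}$ (resp. $a_i=p_i^{e_{i,1}}$) is the maximal power of $p_i$ dividing $b$ (resp. $a$), so that $e_{i,1}+e_{i,2}=e_i$ (some or all of the $e_{i,j}$ may be $0$).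
   Context: A partition $\lambda\vdash n$ is written $[n^{m_n},\dots,2^{m_2},1^{m_1}]$, where $m_j=m_j(\lambda)$ is the number of parts equal to $j$. $C_\lambda\subset S_n$ is the conjugacy class of permutations of cycle type $\lambda$. For a function $f$ on $S_n$ and $Y\subseteq S_n$, $f(Y):=\sum_{g\in Y}f(g)$; $|f|(g):=|f(g)|$; the total (signed) mass of $f$ is $f(S_n)$. The $m$-th necklace polynomial is $M_m(X)=\frac1m\sum_{d\mid m}\mu(d)X^{m/d}$. The cycle polynomial of $\lambda\vdash n$ is $N_\lambda(X)=\prod_{j=1}^n\binom{M_j(X)}{m_j(\lambda)}$, where $\binom{t}{k}=\frac{t(t-1)\cdots(t-k+1)}{k!}$. For $n\ge 2$ every $N_\lambda(X)$ is divisible by $X-1$, and the $1$-splitting measure on $S_n$ is the class function with $\nu_{n,1}^{\ast}(C_\lambda)=\left.\frac{N_\lambda(X)}{X^{n-1}(X-1)}\right|_{X=1}$. The measures $\omega_n$ on $S_n$ ($n\ge1$) are the class functions defined recursively by $\omega_1(C_{[1]})=1$ and, for $n\ge2$: $\omega_n(C_\lambda)=\nu_{n,1}^{\ast}(C_\lambda)$ if $\lambda=[b^a]$ with $ab=n$ and $b>1$; $\omega_n(C_{[1^n]})=\nu_{n,1}^{\ast}(C_{[1^n]})-\omega_{n-1}(C_{[1^{n-1}]})$; and $\omega_n(C_\lambda)=0$ for all other $\lambda$. *)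

(* Defs.v *)
From mathcomp Require Import all_boot all_order all_fingroup all_algebra all_solvable.

Set Implicit Arguments.
Unset Strict Implicit.
Unset Printing Implicit Defensive.

Import Order.TTheory GRing.Theory Num.Theory.
Local Open Scope ring_scope.

(* Partitions are the nonincreasing sequences of their parts: m_j(la) is
   count_mem j la, and [b^a] is nseq a b. *)

Definition cycle_type (n : nat) (g : 'S_n) : seq nat :=
  sort geq [seq #|B| | B : {set 'I_n} <- enum (porbits g)].

Definition cycle_class (n : nat) (la : seq nat) : {set 'S_n} :=
  [set g : 'S_n | cycle_type g == la].

Arguments cycle_class n la : clear implicits.

Definition mass (n : nat) (f : 'S_n -> rat) (Y : {set 'S_n}) : rat :=
  \sum_(g in Y) f g.

(* The class function f on S_n such that mass f C_la = v la for all la |- n. *)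
Definition class_fun (n : nat) (v : seq nat -> rat) (g : 'S_n) : rat :=
  v (cycle_type g) / #|cycle_class n (cycle_type g)|%:R.

Definition probability_on (n : nat) (f : 'S_n -> rat) (Y : {set 'S_n}) : Prop :=
  (forall g : 'S_n, g \in Y -> 0 <= f g) /\ mass f Y = 1.

Definition mobius (d : nat) : rat :=
  if all (fun p => logn p d == 1%N) (primes d) then (-1) ^+ size (primes d)
  else 0.

Definition necklace_poly (m : nat) : {poly rat} :=
  m%:R^-1 *: \sum_(d <- divisors m) mobius d *: 'X^(m %/ d).

Definition binom_poly (t : {poly rat}) (k : nat) : {poly rat} :=
  (k`!%:R)^-1 *: \prod_(i < k) (t - i%:R).

Definition cycle_poly (la : seq nat) : {poly rat} :=
  \prod_(1 <= j < (sumn la).+1) binom_poly (necklace_poly j) (count_mem j la).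

(* The 1-splitting measure, for n >= 2.  Since 'X - 1 then divides
   cycle_poly la, the polynomial division below is exact. *)
Definition splitting_measure (n : nat) : 'S_n -> rat :=
  class_fun (fun la =>
    (cycle_poly la %/ ('X - 1)).[1] / ('X^(n.-1) : {poly rat}).[1]).

Arguments splitting_measure n g : clear implicits.

(* la = [b^a] with ab = n and b > 1. *)
Definition is_nontrivial_rectangle (n : nat) (la : seq nat) : bool :=
  [exists a : 'I_n.+1, exists b : 'I_n.+1,
    [&& (a * b == n)%N, (1 < b)%N & la == nseq a (b : nat)]].

(* The value at n = 0 is irrelevant. *)
Fixpoint omega (n : nat) : 'S_n -> rat :=
  match n return 'S_n -> rat with
  | 0 => fun _ => 0
  | n'.+1 =>
    class_fun (fun la =>
      if n' == 0%N then 1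
      else if is_nontrivial_rectangle n'.+1 la then
        mass (splitting_measure n'.+1) (cycle_class n'.+1 la)
      else if la == nseq n'.+1 1%N then
        mass (splitting_measure n'.+1) (cycle_class n'.+1 (nseq n'.+1 1%N))
        - mass (@omega n') (cycle_class n' (nseq n' 1%N))
      else 0)
  end.

Arguments omega n g : clear implicits.

(* Main.v *)
Require Import Defs.
From mathcomp Require Import all_boot all_order all_fingroup all_algebra all_solvable.
From mathcomp Require Import ring lra.

(** Write [b^a] for the cycle type with [a] cycles of length [b]. Everything
    follows from one closed formula: on the class of [b^a] with [a * b = n],
    omega_n has mass (-1)^(a-1) phi(b) / n ([omega_rect]), and it vanishes on
    all other classes ([omega_support]).

    For b > 1 the b-th necklace polynomial M_b vanishes at 1, since the Moebius
    function sums to 0 over the divisors of b, and its derivative there is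
    phi(b) / b, by Moebius inversion of the identity n = sum of phi(d) over
    d | n. Dividing by X - 1 and evaluating at 1 amounts to taking the
    derivative at 1, and in the derivative of the product
    M_b (M_b - 1) ... (M_b - a + 1) / a! only the term that differentiates the
    first factor survives at 1. This gives (-1)^(a-1) phi(b) / (a b). The class
    of the identity has splitting value (-1)^n / (n (n - 1)), and subtracting
    the value (-1)^n / (n - 1) of omega_(n-1) gives (-1)^(n-1) / n: the
    correction in the recursion is exactly what extends the formula to b = 1.

    A permutation of type [b^a] has the parity of n - a, while the sign of the
    formula depends on the parity of a only; hence omega_n has constant sign on
    each parity class of permutations ([omega_sign]). For n odd only even
    permutations carry mass, all terms are positive, and phi(b) / n adds up to 1
    over the divisors b of n. For n = 2m the even permutations correspond to the
    even cofactors n / b, that is to the divisors b of m, and phi sums to m on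
    them: half of the total mass of |omega_n| ([mass_omega_parity]).
    Finally, both phi(b) / n and the sign (-1)^(a-1) are products over the primes
    dividing n, which gives the factorization ([rect_mass_prod_part]). *)

Set Implicit Arguments.
Unset Strict Implicit.
Unset Printing Implicit Defensive.

Import Order.TTheory GRing.Theory Num.Theory.
Local Open Scope ring_scope.

(** * Moebius inversion for the totient *)

Lemma sum_divisors_dvd (F : nat -> rat) m n : (0 < n)%N -> (m %| n)%N ->
  \sum_(d <- divisors m) F d = \sum_(d <- divisors n | (d %| m)%N) F d.
Proof.
move=> n_gt0 m_dv_n; have m_gt0 := dvdn_gt0 n_gt0 m_dv_n.
rewrite -[RHS]big_filter; apply: perm_big; apply: uniq_perm.
- exact: divisors_uniq.
- by rewrite filter_uniq ?divisors_uniq.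
move=> d; rewrite mem_filter -!dvdn_divisors //.
by apply/idP/andP => [d_dv_m | []//]; split=> //; apply: dvdn_trans m_dv_n.
Qed.

Lemma sum_totient_divisors n : (0 < n)%N ->
  \sum_(d <- divisors n) (totient d)%:R = n%:R :> rat.
Proof.
move=> n_gt0; rewrite -[in RHS](sum_totient_dvd n) natr_sum.
rewrite -(big_mkord (fun d => d %| n)%N (fun d => (totient d)%:R : rat)).
rewrite -[RHS]big_filter; apply: perm_big; apply: uniq_perm.
- exact: divisors_uniq.
- by rewrite filter_uniq ?iota_uniq.
move=> d; rewrite mem_filter mem_index_iota -dvdn_divisors //= ltnS.
by apply/idP/andP => [d_dv_n | []//]; split=> //; apply: dvdn_leq.
Qed.

Lemma mobius1 : mobius 1 = 1.
Proof. by []. Qed.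

Lemma mobius_square_dvd p d : prime p -> (0 < d)%N -> (p ^ 2 %| d)%N ->
  mobius d = 0.
Proof.
move=> p_pr d_gt0 p2_dv_d; rewrite /mobius ifN //; apply/allPn; exists p.
  by rewrite mem_primes p_pr d_gt0 (dvdn_trans _ p2_dv_d) // expnS dvdn_mulr.
by rewrite neq_ltn orbC -pfactor_dvdn // p2_dv_d.
Qed.

Lemma mobius_mul_prime p d : prime p -> (0 < d)%N -> ~~ (p %| d)%N ->
  mobius (p * d) = - mobius d.
Proof.
move=> p_pr d_gt0 p_ndv_d; have p_gt0 := prime_gt0 p_pr.
have p_new : p \notin primes d by rewrite mem_primes p_pr d_gt0.
have primes_pd : perm_eq (primes (p * d)) (p :: primes d).
  apply: uniq_perm; rewrite /= ?primes_uniq ?p_new // => q.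
  by rewrite primesM // primes_prime // inE in_cons.
rewrite /mobius (perm_all _ primes_pd) (perm_size primes_pd) /=.
rewrite lognM // logn_prime // eqxx lognE p_pr d_gt0 (negPf p_ndv_d) /=.
have -> : all (fun q => logn q (p * d) == 1%N) (primes d)
          = all (fun q => logn q d == 1%N) (primes d).
  apply: eq_in_all => q q_in; rewrite lognM // logn_prime //.
  by have [eq_qp | _] := eqVneq q p; first by rewrite -eq_qp q_in in p_new.
by case: ifP; rewrite ?oppr0 // exprS mulN1r.
Qed.

(** For a prime p dividing n, multiplication by p maps the divisors of n prime
    to p onto those that p divides exactly once, and reverses the sign of the
    Moebius function; the remaining divisors contribute nothing. *)
Lemma sum_mobius_divisors n : (1 < n)%N -> \sum_(d <- divisors n) mobius d = 0.
Proof.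
move=> n_gt1; have n_gt0 := ltnW n_gt1.
have p_pr := pdiv_prime n_gt1; set p := pdiv n in p_pr.
have p_dv_n : (p %| n)%N := pdiv_dvd n.
(* The three parts are the divisors with p-valuation at least 2, 1 and 0. *)
rewrite (bigID (fun d => p %| d)%N) /= (bigID (fun d => p ^ 2 %| d)%N) /=.
rewrite [X in X + _ + _]big_seq_cond big1 => [|d /and3P[d_in _ p2_dv_d]]; last first.
  apply: mobius_square_dvd p2_dv_d => //.
  by rewrite -dvdn_divisors // in d_in; apply: dvdn_gt0 d_in.
rewrite add0r -big_filter.
have /(perm_big _) -> :
    perm_eq [seq d <- divisors n | (p %| d) && ~~ (p ^ 2 %| d)]%N
            [seq (p * d)%N | d <- divisors n & ~~ (p %| d)%N].
  apply: uniq_perm; first by rewrite filter_uniq ?divisors_uniq.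
    rewrite map_inj_uniq ?filter_uniq ?divisors_uniq // => d1 d2 /eqP.
    by rewrite eqn_pmul2l ?prime_gt0 // => /eqP.
  move=> d; rewrite mem_filter -dvdn_divisors //.
  apply/idP/mapP => [/andP[/andP[/dvdnP[e ->]]] | [e]].
    rewrite mulnC expnS expn1 dvdn_pmul2l ?prime_gt0 // => p_ndv_e pe_dv_n.
    exists e => //; rewrite mem_filter p_ndv_e -dvdn_divisors //.
    exact: dvdn_trans (dvdn_mull _ _) pe_dv_n.
  rewrite mem_filter -dvdn_divisors // => /andP[p_ndv_e e_dv_n ->].
  rewrite dvdn_mulr // expnS expn1 dvdn_pmul2l ?prime_gt0 // p_ndv_e /=.
  by rewrite Gauss_dvd ?prime_coprime // p_dv_n.
rewrite big_map big_filter big_seq_cond [X in _ + X]big_seq_cond -big_split /=.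
apply: big1 => d /andP[d_in p_ndv_d]; rewrite -dvdn_divisors // in d_in.
by rewrite mobius_mul_prime ?addNr //; apply: dvdn_gt0 d_in.
Qed.

(** Expand n / d as the sum of phi(e) over e | n / d and exchange the sums: the
    coefficient of phi(e) is the sum of the Moebius function over the divisors
    of n / e, which vanishes unless e = n. *)
Lemma totient_mobius n : (0 < n)%N ->
  \sum_(d <- divisors n) mobius d * (n %/ d)%:R = (totient n)%:R.
Proof.
move=> n_gt0.
transitivity (\sum_(d <- divisors n) \sum_(e <- divisors n | (d * e %| n)%N)
                 mobius d * (totient e)%:R).
  apply: eq_big_seq => d; rewrite -dvdn_divisors // => d_dv_n.
  have d_gt0 := dvdn_gt0 n_gt0 d_dv_n.
  rewrite -big_distrr /= -sum_totient_divisors ?divn_gt0 ?(dvdn_leq n_gt0) //.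
  rewrite (sum_divisors_dvd _ n_gt0 (dvdn_div d_dv_n)).
  by congr (_ * _); apply: eq_bigl => e; rewrite dvdn_divRL // mulnC.
rewrite (exchange_big_dep xpredT) //=.
have n_in : n \in divisors n by rewrite divisors_id.
rewrite (bigD1_seq n) ?divisors_uniq //= -[RHS]addr0; congr (_ + _).
  rewrite -big_distrl /=.
  rewrite (eq_bigl (fun d => d %| 1)%N) => [|d]; last first.
    by rewrite -{2}[n]mul1n dvdn_pmul2r.
  rewrite -(sum_divisors_dvd _ n_gt0 (dvd1n n)).
  by rewrite big_seq1 mobius1 mul1r.
rewrite big_seq_cond big1 // => e /andP[]; rewrite -dvdn_divisors //.
move=> e_dv_n e_neq_n; have e_gt0 := dvdn_gt0 n_gt0 e_dv_n.
rewrite -big_distrl /=.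
rewrite (eq_bigl (fun d => d %| n %/ e)%N) => [|d]; last first.
  by rewrite dvdn_divRL // mulnC.
rewrite -(sum_divisors_dvd _ n_gt0 (dvdn_div e_dv_n)).
rewrite sum_mobius_divisors ?mul0r // ltn_divRL // mul1n.
by rewrite ltn_neqAle e_neq_n dvdn_leq.
Qed.

(** * Values of the 1-splitting measure *)

Lemma necklace_poly_root1 b : (1 < b)%N -> (necklace_poly b).[1] = 0.
Proof.
move=> b_gt1; rewrite /necklace_poly hornerZ horner_sum.
rewrite (eq_bigr mobius) ?sum_mobius_divisors ?mulr0 // => d _.
by rewrite hornerZ hornerXn expr1n mulr1.
Qed.

Lemma necklace_poly_deriv1 b : (0 < b)%N ->
  (necklace_poly b)^`().[1] = (totient b)%:R / b%:R.
Proof.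
move=> b_gt0; rewrite /necklace_poly derivZ hornerZ (big_morph _ (@derivD _) (deriv0 _)) horner_sum.
rewrite -totient_mobius // mulrC; congr (_ / _); apply: eq_bigr => d _.
by rewrite derivZ hornerZ derivXn hornerMn hornerXn expr1n.
Qed.

Lemma necklace_poly1 : necklace_poly 1 = 'X.
Proof. by rewrite /necklace_poly big_seq1 mobius1 invr1 !scale1r. Qed.

(** Differentiate p = q * (X - c): at c only the term with the derivative of
    X - c remains. This turns the splitting values into derivatives. *)
Lemma divp_XsubC_root (F : fieldType) (p : {poly F}) (c : F) : root p c ->
  (p %/ ('X - c%:P)).[c] = p^`().[c].
Proof.
rewrite -dvdp_XsubCl => /divpK {2}<-.
by rewrite derivM derivXsubC mulr1 hornerD hornerM hornerXsubC subrr mulr0 add0r.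
Qed.

Lemma prod_opp_succ n : \prod_(i < n) (- i.+1%:R) = (-1) ^+ n * n`!%:R :> rat.
Proof.
rewrite prodrN card_ord; congr (_ * _).
elim: n => [|n IHn]; first by rewrite big_ord0.
by rewrite big_ord_recr /= IHn factS mulnC natrM.
Qed.

Lemma binom_poly_root1 (t : {poly rat}) a : t.[1] = 0 ->
  root (binom_poly t a.+1) 1.
Proof.
move=> t1; rewrite /binom_poly big_ord_recl subr0 rootE hornerZ hornerM t1.
by rewrite mul0r mulr0.
Qed.

(** Only the factor t of the product t (t - 1) ... (t - a) vanishes at 1, so by
    the product rule the other factors may be evaluated at t = 0. *)
Lemma binom_poly_deriv1 (t : {poly rat}) a : t.[1] = 0 ->
  (binom_poly t a.+1)^`().[1] = (-1) ^+ a / a.+1%:R * t^`().[1].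
Proof.
move=> t1; rewrite /binom_poly derivZ hornerZ big_ord_recl subr0 derivM.
rewrite hornerD !hornerM t1 mul0r addr0 horner_prod.
rewrite (eq_bigr (fun i : 'I_a => - i.+1%:R)) => [|i _]; last first.
  by rewrite hornerD t1 add0r hornerN -polyC_natr hornerC.
rewrite prod_opp_succ factS natrM invfM.
have fact_neq0 : a`!%:R != 0 :> rat by rewrite pnatr_eq0 -lt0n fact_gt0.
by field; rewrite fact_neq0 nat1r pnatr_eq0.
Qed.

Lemma cycle_poly_nseq a b : (0 < a)%N -> (0 < b)%N ->
  cycle_poly (nseq a b) = binom_poly (necklace_poly b) a.
Proof.
move=> a_gt0 b_gt0; rewrite /cycle_poly sumn_nseq.
rewrite (bigD1_seq b) ?iota_uniq //=; last first.
  by rewrite mem_index_iota b_gt0 ltnS leq_pmulr.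
rewrite count_nseq /= eqxx mul1n big1 ?mulr1 // => j j_neq_b.
rewrite count_nseq /= eq_sym (negPf j_neq_b) mul0n /binom_poly big_ord0.
by rewrite fact0 invr1 scale1r.
Qed.

Lemma divp_X_sub1 p : (p %/ ('X - 1) : {poly rat}) = p %/ ('X - 1%:P).
Proof. by rewrite polyC1. Qed.

(** The closed formula for the mass of the class of [b^a]. *)
Definition rect_mass (a b : nat) : rat :=
  (-1) ^+ a.-1 * (totient b)%:R / (a * b)%:R.

Lemma splitting_value_rect a b : (0 < a)%N -> (1 < b)%N ->
  (cycle_poly (nseq a b) %/ ('X - 1)).[1] = rect_mass a b.
Proof.
move=> a_gt0 b_gt1; have b_gt0 := ltnW b_gt1; have t1 := necklace_poly_root1 b_gt1.
rewrite cycle_poly_nseq // divp_X_sub1; case: a a_gt0 => // a _.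
rewrite divp_XsubC_root ?binom_poly_root1 // binom_poly_deriv1 //.
rewrite necklace_poly_deriv1 // /rect_mass natrM invfM; field.
by rewrite nat1r !pnatr_eq0 -lt0n b_gt0.
Qed.

(** Here X - 1 is itself one of the factors of the product, and the factors
    X - (i + 2) after it take the values - (i + 1) at 1. *)
Lemma splitting_value_ones n :
  (cycle_poly (nseq n.+2 1) %/ ('X - 1)).[1] =
  (-1) ^+ n / (n.+2%:R * n.+1%:R) :> rat.
Proof.
rewrite cycle_poly_nseq // necklace_poly1 divp_X_sub1 /binom_poly.
rewrite !big_ord_recl subr0 polyC1 mulrCA scalerAr mulrC mulpK; last first.
  by rewrite -polyC1 polyXsubC_eq0.
rewrite hornerZ hornerM hornerX mul1r horner_prod.
rewrite (eq_bigr (fun i : 'I_n => - i.+1%:R)) => [|i _]; last first.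
  rewrite hornerD hornerX hornerN -polyC_natr hornerC.
  by rewrite /= /bump /= !add1n -natr1 opprD addrC addrNK.
have fact_neq0 : n`!%:R != 0 :> rat by rewrite pnatr_eq0 -lt0n fact_gt0.
rewrite prod_opp_succ !factS !natrM !invfM; field.
by rewrite fact_neq0 nat1r -natrD !pnatr_eq0.
Qed.

(** * Rectangular conjugacy classes *)

Lemma porbits_partition n (g : 'S_n) : partition (porbits g) [set: 'I_n].
Proof.
have -> : porbits g = [set orbit 'P <[g]>%g x | x in [set: 'I_n]].
  rewrite /porbits porbitE; apply/setP => B.
  by apply/imsetP/imsetP => -[x _ ->]; exists x.
by apply: orbit_partition; apply/actsP => h _ x; rewrite !inE.
Qed.

Lemma size_cycle_type n (g : 'S_n) : size (cycle_type g) = #|porbits g|.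
Proof. by rewrite size_sort size_map -cardE. Qed.

Lemma sumn_cycle_type n (g : 'S_n) : sumn (cycle_type g) = n.
Proof.
rewrite (perm_sumn (permEl (perm_sort _ _))) sumnE big_map big_enum /=.
by rewrite -(card_partition (porbits_partition g)) cardsT card_ord.
Qed.

Lemma cycle_type_nseq n (g : 'S_n) b : (0 < b)%N ->
  (forall x, #|porbit g x| = b) -> cycle_type g = nseq (n %/ b) b.
Proof.
move=> b_gt0 card_b.
have cyc_b : all (pred1 b) (cycle_type g).
  apply/allP => k; rewrite mem_sort => /mapP[B].
  by rewrite mem_enum => /imsetP[x _ ->] ->; rewrite /= card_b.
have := sumn_cycle_type g; move: cyc_b => /all_pred1P ->.
by rewrite sumn_nseq => size_g; rewrite -[in RHS]size_g mulKn.
Qed.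

(** The cycle of x has length at most b because b is the first return time of x,
    and length divisible by b because that length is a return time. *)
Lemma card_porbit_period n (g : 'S_n) b x : (0 < b)%N ->
  (forall k, ((g ^+ k)%g x == x) = (b %| k)%N) -> #|porbit g x| = b.
Proof.
move=> b_gt0 period.
have b_dv : (b %| #|porbit g x|)%N by rewrite -period permX iter_porbit.
have card_gt0 : (0 < #|porbit g x|)%N by apply/card_gt0P; exists x; exact: porbit_id.
apply/eqP; rewrite eqn_leq andbC dvdn_leq //= leqNgt; apply/negP => b_lt.
have /(nth_uniq x) distinct := uniq_traject_porbit g x.
have := distinct 0%N b; rewrite !size_traject !nth_traject // => /(_ card_gt0 b_lt).
by rewrite /= -permX eq_sym period dvdnn eq_sym eqn0Ngt b_gt0.
Qed.

(** Translation by a in Z/(a b) has order b at every point. Inhabitants are needed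
    because a class function given by class masses is 0 on an empty class,
    whatever its prescribed mass. *)
Lemma rect_class_inhabited n a b : (0 < n)%N -> (a * b = n)%N ->
  exists g : 'S_n, cycle_type g = nseq a b.
Proof.
case: n => // n _ ab_n; pose s := perm (GRing.addrI (inZp a : 'I_n.+1)).
have [a_gt0 b_gt0] : (0 < a)%N /\ (0 < b)%N by apply/andP; rewrite -muln_gt0 ab_n.
exists s; rewrite (@cycle_type_nseq _ _ b) // => [|x].
  by rewrite -ab_n mulnK.
apply: card_porbit_period => // k.
have -> : (s ^+ k)%g x = inZp a *+ k + x.
  rewrite permX; elim: k => [|k IHk]; first by rewrite mulr0n add0r.
  by rewrite iterS IHk permE mulrS addrA.
rewrite -[X in _ == X]add0r (inj_eq (GRing.addIr x)).
rewrite Zp_mulrn -val_eqE /= modnMml -/(dvdn _ _) -ab_n.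
by rewrite dvdn_pmul2l.
Qed.

Lemma odd_perm_rect n (g : 'S_n) a b : cycle_type g = nseq a b ->
  odd_perm g = odd n (+) odd a.
Proof.
move=> g_ab; rewrite /odd_perm card_ord; congr (_ (+) odd _).
by rewrite -size_cycle_type g_ab size_nseq.
Qed.

(** * Values of omega on rectangular classes *)

Lemma mass_class_fun n (v : seq nat -> rat) (g : 'S_n) :
  mass (class_fun v) (cycle_class n (cycle_type g)) = v (cycle_type g).
Proof.
have g_in : g \in cycle_class n (cycle_type g) by rewrite inE.
rewrite /mass (eq_bigr (fun=> class_fun v g)) => [|h]; last first.
  by rewrite inE /class_fun => /eqP ->.
rewrite sumr_const -mulr_natr mulfVK // pnatr_eq0 -lt0n.
by apply/card_gt0P; exists g.
Qed.

Lemma mass_class_fun_rect n a b (v : seq nat -> rat) : (0 < n)%N ->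
  (a * b = n)%N -> mass (class_fun v) (cycle_class n (nseq a b)) = v (nseq a b).
Proof.
move=> n_gt0 ab_n; have [g <-] := rect_class_inhabited n_gt0 ab_n.
exact: mass_class_fun.
Qed.

Lemma mass_splitting_rect n a b : (0 < n)%N -> (a * b = n)%N ->
  mass (splitting_measure n) (cycle_class n (nseq a b)) =
  (cycle_poly (nseq a b) %/ ('X - 1)).[1].
Proof.
move=> n_gt0 ab_n; rewrite mass_class_fun_rect //.
by rewrite hornerXn expr1n divr1.
Qed.

Lemma nontrivial_rectangleP n la : (0 < n)%N -> reflect
  (exists a b, [/\ (a * b = n)%N, (1 < b)%N & la = nseq a b])
  (is_nontrivial_rectangle n la).
Proof.
move=> n_gt0; apply: (iffP existsP) => [[a /existsP[b /and3P[]]] | [a [b [ab_n b_gt1 ->]]]].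
  by move=> /eqP ab_n b_gt1 /eqP ->; exists a, b.
have a_lt : (a < n.+1)%N by rewrite ltnS dvdn_leq // -ab_n dvdn_mulr.
have b_lt : (b < n.+1)%N by rewrite ltnS dvdn_leq // -ab_n dvdn_mull.
exists (Ordinal a_lt); apply/existsP; exists (Ordinal b_lt) => /=.
by rewrite ab_n b_gt1 !eqxx.
Qed.

Lemma omega_succ n :
  omega n.+2 = class_fun (fun la =>
    if is_nontrivial_rectangle n.+2 la then
      mass (splitting_measure n.+2) (cycle_class n.+2 la)
    else if la == nseq n.+2 1%N then
      mass (splitting_measure n.+2) (cycle_class n.+2 (nseq n.+2 1%N))
      - mass (omega n.+1) (cycle_class n.+1 (nseq n.+1 1%N))
    else 0).
Proof. by []. Qed.

Lemma omega_rect n a b : (0 < n)%N -> (a * b = n)%N ->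
  mass (omega n) (cycle_class n (nseq a b)) = rect_mass a b.
Proof.
elim: n a b => // -[|n] IHn a b _ ab_n.
  rewrite mass_class_fun_rect //.
  by move/eqP: ab_n; rewrite muln_eq1 => /andP[/eqP -> /eqP ->].
have [a_gt0 b_gt0] : (0 < a)%N /\ (0 < b)%N by apply/andP; rewrite -muln_gt0 ab_n.
rewrite omega_succ mass_class_fun_rect //.
have [b_le1 | b_gt1] := leqP b 1; last first.
  have -> : is_nontrivial_rectangle n.+2 (nseq a b).
    by apply/nontrivial_rectangleP => //; exists a, b.
  by rewrite mass_splitting_rect // splitting_value_rect.
have b1 : b = 1%N by apply/eqP; rewrite eqn_leq b_le1.
rewrite {}b1 muln1 in ab_n *; rewrite {}ab_n eqxx ifN; last first.
  apply/nontrivial_rectangleP => // -[[|c] [d [_ d_gt1]]] // [d1 _].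
  by rewrite -d1 in d_gt1.
rewrite mass_splitting_rect ?muln1 // splitting_value_ones IHn ?muln1 //.
have totient1 : totient 1 = 1%N by [].
rewrite /rect_mass totient1 !muln1 exprS; field.
by rewrite ?natr1 ?nat1r -?natrD !pnatr_eq0.
Qed.

Lemma omega_class_const n (g : 'S_n) : (0 < n)%N ->
  omega n g = mass (omega n) (cycle_class n (cycle_type g))
              / #|cycle_class n (cycle_type g)|%:R.
Proof. by case: n g => // n g _; rewrite mass_class_fun. Qed.

Lemma omega_support n (g : 'S_n) : (0 < n)%N -> omega n g != 0 ->
  exists a b, (a * b = n)%N /\ cycle_type g = nseq a b.
Proof.
case: n g => // -[|n] g _.
  move=> _; exists 1%N, 1%N; split=> //; apply: (@cycle_type_nseq 1 g 1) => // x.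
  apply/eqP; rewrite eqn_leq -[X in (_ <= X)%N](card_ord 1) max_card.
  by apply/card_gt0P; exists x; apply: porbit_id.
rewrite omega_succ /class_fun.
case: nontrivial_rectangleP => // [[a [b [ab_n _ g_ab]]] _ | _].
  by exists a, b.
have [g_ones _ | _] := eqVneq (cycle_type g) (nseq n.+2 1%N); last by rewrite mul0r eqxx.
by exists n.+2, 1%N; rewrite muln1.
Qed.

Lemma nseq_rect_inj n a b a' b' : (0 < n)%N -> (a * b = n)%N ->
  nseq a b = nseq a' b' -> b = b'.
Proof.
by move=> n_gt0 ab_n; move: n_gt0; rewrite -ab_n; case: a {ab_n} a' => [|a] [|a'] // _ [].
Qed.

(** Omega vanishes off the rectangular classes, so that its mass on a union Y of
    conjugacy classes is a sum over divisors. *)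
Lemma mass_omega_rect n (P : pred nat) (Y : {set 'S_n}) : (0 < n)%N ->
  (forall a b (g : 'S_n), (a * b = n)%N -> cycle_type g = nseq a b ->
     (g \in Y) = P b) ->
  mass (omega n) Y = \sum_(b <- divisors n | P b) rect_mass (n %/ b) b.
Proof.
move=> n_gt0 YP.
transitivity (\sum_(b <- divisors n | P b)
                 mass (omega n) (cycle_class n (nseq (n %/ b) b))); last first.
  rewrite big_seq_cond [RHS]big_seq_cond; apply: eq_bigr => b /andP[b_in _].
  by rewrite omega_rect // divnK // dvdn_divisors.
rewrite /mass big_mkcond /=.
under [RHS]eq_bigr do rewrite big_mkcond /=.
rewrite exchange_big /=; apply: eq_bigr => g _.
have [omega0 | omega_neq0] := eqVneq (omega n g) 0.
  by rewrite omega0 big1 => [|b _]; rewrite if_same.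
have [a [b [ab_n g_ab]]] := omega_support n_gt0 omega_neq0.
have b_gt0 : (0 < b)%N by move: n_gt0; rewrite -ab_n muln_gt0 => /andP[].
have b_in : b \in divisors n by rewrite -dvdn_divisors // -ab_n dvdn_mull.
rewrite big_mkcond (bigD1_seq b) ?divisors_uniq //= (YP a b) //.
have a_def : (n %/ b = a)%N by rewrite -ab_n mulnK.
rewrite inE g_ab a_def eqxx big1 ?addr0 // => c c_neq_b.
rewrite inE g_ab; case: eqP => [/(nseq_rect_inj n_gt0 ab_n) bc | _].
  by rewrite bc eqxx in c_neq_b.
by rewrite if_same.
Qed.

(** * Total masses *)

Lemma rect_mass_sign a b : (0 < a)%N ->
  rect_mass a b = (-1) ^+ (~~ odd a) * ((totient b)%:R / (a * b)%:R).
Proof. by case: a => // a _; rewrite /rect_mass -signr_odd negbK mulrA. Qed.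

(** On the class of [b^a] both the sign of omega and, once n is fixed, the parity
    of the permutation are determined by the parity of a. *)
Lemma omega_sign n (g : 'S_n) : (0 < n)%N ->
  `|omega n g| = (-1) ^+ (odd n == odd_perm g) * omega n g.
Proof.
move=> n_gt0; have [-> | omega_neq0] := eqVneq (omega n g) 0.
  by rewrite normr0 mulr0.
have [a [b [ab_n g_ab]]] := omega_support n_gt0 omega_neq0.
have a_gt0 : (0 < a)%N by move: n_gt0; rewrite -ab_n muln_gt0 => /andP[].
rewrite omega_class_const // g_ab omega_rect // rect_mass_sign //.
rewrite (odd_perm_rect g_ab) -!mulrA normrMsign.
have -> : (odd n == odd n (+) odd a) = ~~ odd a by case: (odd n); case: (odd a).
by rewrite signrMK ger0_norm // !mulr_ge0 ?invr_ge0 ?ler0n.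
Qed.

Lemma omega_ge0 n (g : 'S_n) : (0 < n)%N -> odd n != odd_perm g ->
  0 <= omega n g.
Proof.
move=> n_gt0 /negPf parity.
by rewrite -[omega n g]mul1r -[1]/((-1) ^+ false) -parity -omega_sign.
Qed.

Lemma omega_le0 n (g : 'S_n) : (0 < n)%N -> odd n == odd_perm g ->
  omega n g <= 0.
Proof.
move=> n_gt0 parity; rewrite -oppr_ge0 -mulN1r -[-1]/((-1) ^+ true) -parity.
by rewrite -omega_sign.
Qed.

Lemma omega_odd_support n (g : 'S_n) : odd n -> omega n g != 0 -> ~~ odd_perm g.
Proof.
move=> n_odd /(omega_support (odd_gt0 n_odd))[a [b [ab_n g_ab]]].
by rewrite (odd_perm_rect g_ab); move: n_odd; rewrite -ab_n oddM => /andP[-> ->].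
Qed.

Lemma sum_totient_ratio n : (0 < n)%N ->
  \sum_(b <- divisors n) (totient b)%:R / n%:R = 1 :> rat.
Proof.
move=> n_gt0; rewrite -mulr_suml sum_totient_divisors // divff //.
by rewrite pnatr_eq0 -lt0n.
Qed.

(** The totients of the divisors of m add up to m, half of 2 m. *)
Lemma sum_totient_ratio_half m : (0 < m)%N ->
  \sum_(b <- divisors (2 * m) | (b %| m)%N)
     (totient b)%:R / (2 * m)%:R = 2^-1 :> rat.
Proof.
move=> m_gt0; rewrite -mulr_suml -sum_divisors_dvd ?muln_gt0 ?dvdn_mull //.
rewrite sum_totient_divisors // natrM invfM mulrCA mulfV ?mulr1 //.
by rewrite pnatr_eq0 -lt0n.
Qed.

Lemma sum_totient_ratio_half_compl m : (0 < m)%N ->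
  \sum_(b <- divisors (2 * m) | ~~ (b %| m)%N)
     (totient b)%:R / (2 * m)%:R = 2^-1 :> rat.
Proof.
move=> m_gt0; have n_gt0 : (0 < 2 * m)%N by rewrite muln_gt0.
have := sum_totient_ratio n_gt0; rewrite (bigID (fun b => b %| m)%N) /=.
by rewrite sum_totient_ratio_half // => half_sum; lra.
Qed.

(** Since 2 m = a b, having a even means that m is a multiple of b. *)
Lemma odd_cofactor m a b : (0 < b)%N -> (a * b = 2 * m)%N ->
  odd a = ~~ (b %| m)%N.
Proof.
move=> b_gt0 ab_2m; apply/idP/idP => [a_odd | b_ndv_m].
  apply/negP => /dvdnP[c m_cb]; move/eqP: ab_2m.
  rewrite m_cb mulnA eqn_pmul2r // => /eqP a_2c.
  by rewrite a_2c oddM in a_odd.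
apply: contraR b_ndv_m => a_even; apply/dvdnP; exists a./2; apply/eqP.
rewrite -(eqn_pmul2l (_ : 0 < 2)%N) // -ab_2m mulnA.
by rewrite mul2n even_halfK.
Qed.

Lemma rect_mass_cofactor n b : (0 < n)%N -> (b %| n)%N ->
  rect_mass (n %/ b) b = (-1) ^+ (~~ odd (n %/ b)) * ((totient b)%:R / n%:R).
Proof.
move=> n_gt0 b_dv_n.
have b_gt0 := dvdn_gt0 n_gt0 b_dv_n; have b_le_n := dvdn_leq n_gt0 b_dv_n.
by rewrite rect_mass_sign ?divnK // divn_gt0.
Qed.

Lemma mass_omega_odd n : odd n -> mass (omega n) [set: 'S_n] = 1.
Proof.
move=> n_odd; have n_gt0 := odd_gt0 n_odd.
rewrite (@mass_omega_rect _ xpredT) // => [|a b g _ _]; last by rewrite inE.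
rewrite -(sum_totient_ratio n_gt0); apply: eq_big_seq => b.
rewrite -dvdn_divisors // => b_dv_n.
by rewrite rect_mass_cofactor // (dvdn_odd (dvdn_div b_dv_n)) // mul1r.
Qed.

(** The parity of a permutation of type [b^a] in even degree is that of a, which
    is also the sign of the formula; the two parities then share the divisors
    b of 2 m according to whether b divides m. *)
Lemma mass_omega_parity m (e : bool) : (0 < m)%N ->
  mass (omega (2 * m)) [set g : 'S_(2 * m) | odd_perm g == e] =
  (-1) ^+ (~~ e) * 2^-1.
Proof.
move=> m_gt0; have n_gt0 : (0 < 2 * m)%N by rewrite muln_gt0.
rewrite (@mass_omega_rect _ (fun b => ~~ (b %| m)%N == e)) // => [|a b g ab_n g_ab].
  transitivity (\sum_(b <- divisors (2 * m) | ~~ (b %| m)%N == e)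
                   (-1) ^+ (~~ e) * ((totient b)%:R / (2 * m)%:R) : rat).
    rewrite big_seq_cond [RHS]big_seq_cond; apply: eq_bigr => b /andP[].
    rewrite -dvdn_divisors // => b_dv_n /eqP <-; rewrite rect_mass_cofactor //.
    by rewrite (@odd_cofactor m _ b) ?divnK ?(dvdn_gt0 n_gt0).
  rewrite -mulr_sumr; congr (_ * _); case: e.
    rewrite -(sum_totient_ratio_half_compl m_gt0).
    by apply: eq_bigl => b; rewrite eqb_id.
  rewrite -(sum_totient_ratio_half m_gt0).
  by apply: eq_bigl => b; rewrite eqbF_neg negbK.
have b_gt0 : (0 < b)%N by move: n_gt0; rewrite -ab_n muln_gt0 => /andP[].
by rewrite inE (odd_perm_rect g_ab) oddM (odd_cofactor b_gt0 ab_n).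
Qed.

Lemma mass_split_parity n (f : 'S_n -> rat) :
  mass f [set: 'S_n] = mass f [set g : 'S_n | odd_perm g == true]
                       + mass f [set g : 'S_n | odd_perm g == false].
Proof.
rewrite /mass (bigID (@odd_perm _)) /=.
by congr (_ + _); apply: eq_bigl => g; rewrite !inE ?eqb_id ?eqbF_neg.
Qed.

Lemma mass_abs_omega n : (0 < n)%N ->
  mass (fun g => `|omega n g|) [set: 'S_n] = 1.
Proof.
move=> n_gt0; have [n_odd | n_even] := boolP (odd n).
  rewrite -(mass_omega_odd n_odd); apply: eq_bigr => g _.
  have [-> | omega_neq0] := eqVneq (omega n g) 0; first exact: normr0.
  by rewrite omega_sign // n_odd (negPf (omega_odd_support n_odd omega_neq0)) mul1r.
have nE : n = (2 * n./2)%N by rewrite mul2n even_halfK.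
have m_gt0 : (0 < n./2)%N by move: n_gt0; rewrite {1}nE muln_gt0.
move: n_gt0; rewrite nE => n_gt0; rewrite mass_split_parity.
have abs_mass (e : bool) : mass (fun g => `|omega (2 * n./2) g|)
    [set g : 'S_(2 * n./2) | odd_perm g == e] = 2^-1.
  rewrite -[RHS](signrMK (~~ e)) -(mass_omega_parity e m_gt0) mulr_sumr.
  apply: eq_bigr => g.
  by rewrite inE omega_sign // oddM => /eqP ->; case: e.
by rewrite !abs_mass; lra.
Qed.

(** * Multiplicativity *)

Lemma prod_primes_part n : (0 < n)%N -> (\prod_(p <- primes n) p ^ logn p n)%N = n.
Proof. by move=> n_gt0; rewrite [RHS]prod_prime_decomp // prime_decompE big_map. Qed.

(** The primes of n rather than of b index the product, to match the other
    factors of the formula; those not dividing b contribute phi(1) = 1. *)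
Lemma totient_prod_part n b : (0 < n)%N -> (b %| n)%N ->
  totient b = (\prod_(p <- primes n) totient (p ^ logn p b))%N.
Proof.
move=> n_gt0 b_dv_n; have b_gt0 := dvdn_gt0 n_gt0 b_dv_n.
rewrite totientE // [RHS](bigID (fun p => p \in primes b)) /= [X in (_ * X)%N]big1.
  rewrite muln1 -[RHS]big_filter.
  have /(perm_big _) -> : perm_eq [seq p <- primes n | p \in primes b] (primes b).
    apply: uniq_perm; rewrite ?filter_uniq ?primes_uniq // => p.
    rewrite mem_filter andb_idr // !mem_primes n_gt0 b_gt0 /=.
    by case/andP=> -> /dvdn_trans; apply.
  apply: eq_big_seq => p; rewrite -logn_gt0 => p_b.
  rewrite totient_pfactor //.
  by move: p_b; rewrite logn_gt0 mem_primes => /andP[].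
by move=> p; rewrite -logn_gt0 -eqn0Ngt => /eqP ->.
Qed.

Lemma odd_part p n : odd n -> odd (p ^ logn p n).
Proof. by move=> n_odd; rewrite (dvdn_odd _ n_odd) // pfactor_dvdnn. Qed.

(** Only the prime 2 can contribute a sign, and it does so exactly when a is
    even. *)
Lemma sign_prod_part n a : (0 < n)%N -> (a %| n)%N ->
  \prod_(p <- primes n) (-1) ^+ (~~ odd (p ^ logn p a)) =
  (-1) ^+ (~~ odd a) :> rat.
Proof.
move=> n_gt0 a_dv_n; have a_gt0 := dvdn_gt0 n_gt0 a_dv_n.
have [a_odd | a_even] := boolP (odd a).
  by rewrite big1 // => p _; rewrite odd_part.
have a_2 : (2 %| a)%N by rewrite dvdn2.
have n_2 : 2%N \in primes n by rewrite mem_primes n_gt0 (dvdn_trans a_2).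
rewrite (bigD1_seq 2%N) ?primes_uniq //= oddX lognE a_gt0 a_2 /=.
rewrite big_seq_cond big1 ?mulr1 // => p /andP[p_in p_neq2].
have p_pr : prime p by move: p_in; rewrite mem_primes => /andP[].
by rewrite oddX; case: (even_prime p_pr) p_neq2 => [-> // | ->]; rewrite orbT.
Qed.

Lemma rect_mass_prod_part n a b : (0 < n)%N -> (a * b = n)%N ->
  \prod_(p <- primes n) rect_mass (p ^ logn p a) (p ^ logn p b) = rect_mass a b.
Proof.
move=> n_gt0 ab_n.
have [a_gt0 b_gt0] : (0 < a)%N /\ (0 < b)%N by apply/andP; rewrite -muln_gt0 ab_n.
have a_dv_n : (a %| n)%N by rewrite -ab_n dvdn_mulr.
have b_dv_n : (b %| n)%N by rewrite -ab_n dvdn_mull.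
transitivity (\prod_(p <- primes n)
    ((-1) ^+ (~~ odd (p ^ logn p a)) *
     ((totient (p ^ logn p b))%:R / (p ^ logn p n)%:R)) : rat).
  apply: eq_big_seq => p; rewrite mem_primes => /andP[p_pr _].
  by rewrite rect_mass_sign ?expn_gt0 ?prime_gt0 // -expnD -lognM // ab_n.
rewrite !big_split /= sign_prod_part // rect_mass_sign // ab_n prodfV.
by rewrite -!natr_prod -totient_prod_part // prod_primes_part.
Qed.

Theorem theorem3p3 :
  (* (1) *)
  (forall n : nat, (0 < n)%N ->
     probability_on (fun g : 'S_n => `|omega n g|) [set: 'S_n])
  /\
  (* (2) *)
  (forall (n m : nat), n = (2 * m + 1)%N ->
     [/\ forall g : 'S_n, 0 <= omega n g,
         mass (omega n) [set: 'S_n] = 1,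
         probability_on (omega n) [set: 'S_n],
         forall g : 'S_n, omega n g != 0 -> ~~ odd_perm g
       & probability_on (omega n) ('Alt_('I_n))%g])
  /\
  (* (3) *)
  (forall (n m : nat), (0 < n)%N -> n = (2 * m)%N ->
     mass (omega n) [set: 'S_n] = 0 /\
     [/\ forall g : 'S_n, odd_perm g -> 0 <= omega n g,
         mass (omega n) [set g : 'S_n | odd_perm g] = 2^-1,
         forall g : 'S_n, ~~ odd_perm g -> omega n g <= 0,
         mass (omega n) [set g : 'S_n | ~~ odd_perm g] = - 2^-1
       & probability_on (fun g : 'S_n => - 2 * omega n g) ('Alt_('I_n))%g])
  /\
  (* (4) *)
  (forall n a b : nat, (0 < n)%N -> (a * b = n)%N ->
     mass (omega n) (cycle_class n (nseq a b)) =
     \prod_(p <- primes n)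
        mass (omega (p ^ logn p n)%N)
             (cycle_class (p ^ logn p n)
                (nseq (p ^ logn p a) (p ^ logn p b)%N))).
Proof.
have AltE n : ('Alt_('I_n))%g = [set g : 'S_n | ~~ odd_perm g] :> {set 'S_n}.
  by apply/setP => g; rewrite Alt_even inE.
split; [|split; [|split]].
- by move=> n n_gt0; split=> [g _|]; [apply: normr_ge0 | apply: mass_abs_omega].
- move=> n m nE; have n_odd : odd n by rewrite nE oddD oddM.
  have ge0 g : 0 <= omega n g.
    have [-> // | omega_neq0] := eqVneq (omega n g) 0.
    by apply: omega_ge0; rewrite ?odd_gt0 // n_odd eq_sym eqb_id omega_odd_support.
  have total := mass_omega_odd n_odd.
  split=> // [g|]; first exact: omega_odd_support.
  split=> //.
  rewrite -total /mass AltE big_mkcond [RHS]big_mkcond; apply: eq_bigr => g _.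
  rewrite !inE; case: ifPn => // /negPn g_odd.
  by case: eqVneq (@omega_odd_support n g n_odd) => // _ /(_ isT); rewrite g_odd.
- move=> n m n_gt0 nE; have m_gt0 : (0 < m)%N by move: n_gt0; rewrite nE muln_gt0.
  rewrite {}nE in n_gt0 *.
  have odd_mass : mass (omega (2 * m)) [set g : 'S_(2 * m) | odd_perm g] = 2^-1.
    rewrite -[RHS]mul1r -(mass_omega_parity true m_gt0) /mass.
    by apply: eq_bigl => g; rewrite !inE eqb_id.
  have even_mass :
      mass (omega (2 * m)) [set g : 'S_(2 * m) | ~~ odd_perm g] = - 2^-1.
    rewrite -mulN1r -(mass_omega_parity false m_gt0) /mass.
    by apply: eq_bigl => g; rewrite !inE eqbF_neg.
  have le0 (g : 'S_(2 * m)) : ~~ odd_perm g -> omega (2 * m) g <= 0.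
    by move=> g_even; apply: omega_le0 => //; rewrite oddM eq_sym eqbF_neg.
  split; first by rewrite mass_split_parity !mass_omega_parity //= mul1r mulN1r subrr.
  split=> // [g g_odd | ].
    by apply: omega_ge0 => //; rewrite oddM g_odd.
  split=> [g|]; first by rewrite AltE inE => /le0 g_le0; lra.
  by rewrite AltE /mass -mulr_sumr [X in _ * X]even_mass; lra.
move=> n a b n_gt0 ab_n; rewrite omega_rect // -(rect_mass_prod_part n_gt0 ab_n).
have [a_gt0 b_gt0] : (0 < a)%N /\ (0 < b)%N by apply/andP; rewrite -muln_gt0 ab_n.
apply: eq_big_seq => p; rewrite mem_primes => /andP[p_pr _].
by rewrite omega_rect ?expn_gt0 ?prime_gt0 // -expnD -lognM // ab_n.
Qed.
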